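(* Let $n\geq 5$ be an integer, let $W_n$ be the wheel graph on $n$ vertices, and let $W_n-e$ be the subgraph obtained from $W_n$ by deleting an edge $e$ which lies on the cycle. Then the inertia of its eccentricity matrix is $$\operatorname{In}(E(W_n-e))=\begin{cases}\left(\frac{n}{3},\frac{2n-3}{3},1\right) & \text{if } n\equiv 0\pmod 3,\\[2pt] \left(\frac{n+2}{3},\frac{2n-2}{3},0\right) & \text{if } n\equiv 1\pmod 3,\\[2pt] \left(\frac{n+1}{3},\frac{2n-1}{3},0\right) & \text{if } n\equiv 2\pmod 3.\end{cases}$$
   Context: For a real symmetric matrix $A$, the inertia is $\operatorname{In}(A)=(i_+(A),i_-(A),i_0(A))$, where $i_+(A),i_-(A),i_0(A)$ are the numbers of positive, negative and zero eigenvalues of $A$, counted with multiplicity. For a simple connected graph $G$ with vertices $v_1,\dots,v_n$, let $d(v_i,v_j)$ be the length of a shortest path between $v_i$ and $v_j$, and let $e(v_i)=\max\{d(v_i,v_j):1\le j\le n\}$ be the eccentricity of $v_i$. The eccentricity matrix $E(G)$ is the $n\times n$ real matrix with $(E(G))_{ij}=d(v_i,v_j)$ if $d(v_i,v_j)=\min\{e(v_i),e(v_j)\}$, and $(E(G))_{ij}=0$ otherwise (distances and eccentricities computed in $G$). The wheel graph $W_n$ is the graph on $n$ vertices consisting of a cycle of length $n-1$ together with one further vertex (the hub) adjacent to every vertex of the cycle. The vertices are labelled so that $v_1$ is the hub and $v_2,\dots,v_n$ are the cycle vertices in cyclic order. *)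

(* Defs.v *)
From HB Require Import structures.
From mathcomp Require Import all_boot all_order all_algebra.
From mathcomp Require Import polyrcf.

Set Implicit Arguments.
Unset Strict Implicit.
Unset Printing Implicit Defensive.

Import Order.TTheory GRing.Theory Num.Theory.
Local Open Scope ring_scope.

Section Inertia.
Variables (R : rcfType) (n : nat).
Implicit Type A : 'M[R]_n.

Definition spectrum A : seq R := rootsR (char_poly A).

Lemma mem_spectrum A a : (a \in spectrum A) = eigenvalue A a.
Proof.
rewrite eigenvalue_root_char /spectrum.
by rewrite -(roots_on_rootsR (monic_neq0 (char_poly_monic A))) in_itv.
Qed.

Lemma spectrum_uniq A : uniq (spectrum A).
Proof. exact: uniq_roots. Qed.

(* For a symmetric matrix, algebraic and geometric multiplicity agree. *)
Definition eigen_mult A (a : R) : nat := mup a (char_poly A).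

Definition inertia A : nat * nat * nat :=
  ((\sum_(a <- spectrum A | (0 < a)%R) eigen_mult A a)%N,
   (\sum_(a <- spectrum A | (a < 0)%R) eigen_mult A a)%N,
   (\sum_(a <- spectrum A | a == 0%R) eigen_mult A a)%N).

End Inertia.

Section Graph.
Variables (T : finType) (e : rel T).

Definition has_path_of_length (x y : T) (k : nat) : bool :=
  [exists p : k.-tuple T, [&& path e x p, last x p == y & uniq (x :: p)]].

(* The value is the junk #|T| when x and y are not connected. *)
Definition dist (x y : T) : nat :=
  find (has_path_of_length x y) (iota 0 #|T|).

Lemma dist_path x y : connect e x y -> has_path_of_length x y (dist x y).
Proof.
move=> /connectP[p0 /shortenP[p ep up _] ->].
have lt_p : (size p < #|T|)%N.
  by have := max_card (mem (x :: p)); rewrite (card_uniqP up).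
have hp : has (has_path_of_length x (last x p)) (iota 0 #|T|).
  apply/hasP; exists (size p); first by rewrite mem_iota.
  by apply/existsP; exists (in_tuple p); rewrite ep up eqxx.
have := nth_find 0%N hp; rewrite nth_iota //.
by move: hp; rewrite has_find size_iota.
Qed.

Lemma dist_min x y k : has_path_of_length x y k -> (dist x y <= k)%N.
Proof.
move=> hk; rewrite leqNgt; apply/negP => lt_k.
have := before_find 0%N lt_k; rewrite nth_iota ?hk //.
by have := leq_trans lt_k (find_size _ _); rewrite size_iota.
Qed.

Definition ecc (x : T) : nat := \max_(y : T) dist x y.

Definition del_edge (u v : T) : rel T :=
  [rel x y | e x y && ([set x; y] != [set u; v])].

End Graph.

Definition ecc_mx (R : rcfType) (n : nat) (e : rel 'I_n) : 'M[R]_n :=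
  \matrix_(i, j) if dist e i j == minn (ecc e i) (ecc e j)
                 then (dist e i j)%:R else 0.

Section Wheel.
Variable n : nat.

(* The vertex v_k is the ordinal k - 1: the hub is 0, and the cycle is
   1, 2, ..., n - 1, 1. *)
Definition cycle_succ (i j : 'I_n) : bool :=
  [&& (0 < i)%N, (0 < j)%N
    & (j == i.+1 :> nat) || (i == n.-1 :> nat) && (j == 1%N :> nat)].

Definition cycle_edge : rel 'I_n :=
  [rel i j : 'I_n | (i != j) && (cycle_succ i j || cycle_succ j i)].

Definition wheel : rel 'I_n :=
  [rel i j : 'I_n | (i != j) && ((i == 0%N :> nat) || (j == 0%N :> nat))
                    || cycle_edge i j].

Lemma cycle_edge_sym : symmetric cycle_edge.
Proof. by move=> i j; rewrite /cycle_edge /= eq_sym orbC. Qed.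

Lemma wheel_sym : symmetric wheel.
Proof.
move=> i j; have := cycle_edge_sym i j; rewrite /wheel /= => ->.
by rewrite eq_sym [X in _ && X || _]orbC.
Qed.

Lemma wheel_irr : irreflexive wheel.
Proof. by move=> i; rewrite /wheel /cycle_edge /= eqxx. Qed.

End Wheel.

Lemma del_edge_sym (T : finType) (e : rel T) u v :
  symmetric e -> symmetric (del_edge e u v).
Proof. by move=> se x y; rewrite /del_edge /= se setUC. Qed.

Lemma del_edge_irr (T : finType) (e : rel T) u v :
  irreflexive e -> irreflexive (del_edge e u v).
Proof. by move=> ie x; rewrite /del_edge /= ie. Qed.

Lemma del_cycle_edge_connected n (u v : 'I_n) :
  cycle_edge u v -> forall x y, connect (del_edge (@wheel n) u v) x y.
Proof.
case: n u v => [[]|n] u v // /andP[_ uvs].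
have [u0 v0] : u != ord0 /\ v != ord0.
  by rewrite -!lt0n; case/orP: uvs => /and3P[].
have hub (x : 'I_n.+1) : connect (del_edge (@wheel n.+1) u v) x ord0.
  have [->|x0] := eqVneq x ord0; first exact: connect0.
  apply: connect1; rewrite /del_edge /wheel /= x0 orbT /=.
  apply/eqP => /setP/(_ ord0).
  by rewrite !inE eqxx orbT eq_sym (negPf u0) eq_sym (negPf v0).
move=> x y; apply: connect_trans (hub x) _.
rewrite (@sym_connect_sym _ (del_edge _ u v)) ?hub //.
exact/del_edge_sym/wheel_sym.
Qed.

(* Main.v *)
Require Import Defs.
From mathcomp Require Import all_boot all_order all_algebra.
From mathcomp Require Import polyrcf.
From mathcomp Require Import perm complex zify ring.

(* Deleting a cycle edge leaves the fan: a hub joined to a path on [m = n - 1]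
   vertices, of diameter 2.  In the coordinates [X = x_0 + sum x_i] (the hub
   coordinate corrected by the path coordinates) its eccentricity form becomes
     [(X, x), (Y, y) |-> X (sum y) + Y (sum x) - 2 x^T T y],
   where [T] is tridiagonal with all entries 1.  The inverse of the 3x3 block of
   [T] has a zero corner, so that eliminating the first three path vertices
   leaves the rest of [T] unchanged; iterating, one gets an explicit
   [T]-orthogonal family with norms 1, -1, 1, 1, -1, 1, ...  The hub contributes
   one more vector, [(2, x)] with [T x = 1], of positive norm.  When
   [m = 2 %[mod 3]] the last vector of the family is replaced by a vector of the
   kernel.  The spectral theorem and Sylvester's law of inertia conclude. *)

Set Implicit Arguments.
Unset Strict Implicit.
Unset Printing Implicit Defensive.

Import Order.TTheory GRing.Theory Num.Theory.
Local Open Scope ring_scope.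
Local Open Scope sesquilinear_scope.

(** * Sylvester's law of inertia *)

Lemma mulmx_diag_trmxC (C : numClosedFieldType) n (a x : 'rV[C]_n) :
  (x *m diag_mx a *m x ^t*) 0 0 = \sum_i a 0 i * `|x 0 i| ^+ 2.
Proof.
rewrite mxE; apply: eq_bigr => i _.
by rewrite mul_mx_diag !mxE normCK; ring.
Qed.

(** With fewer than [m] positive [a 0 i], some nonzero [y] would make [x = y *m S] vanish at all of
    these indices. The value of the form at [x] would be nonpositive when read from [a] and positive
    when read from [b]. *)
Lemma posdef_diag_le (C : numClosedFieldType) n m (a : 'rV[C]_n)
    (b : 'rV[C]_m) (S : 'M[C]_(m, n)) :
    (forall i, a 0 i \is Num.real) -> (forall j, 0 < b 0 j) ->
    S *m diag_mx a *m S ^t* = diag_mx b ->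
  (m <= #|[set i | (0 < a 0 i)%R]|)%N.
Proof.
move=> a_real b_gt0 defb; rewrite leqNgt; apply/negP => lt_m.
set P := [set i | _] in lt_m.
pose K := kermx (colsub (enum_val : 'I_#|P| -> _) S).
have K_neq0 : K != 0.
  by rewrite kermx_eq0 -row_leq_rank -ltnNge (leq_ltn_trans (rank_leq_col _)).
have /rowV0Pn[y /sub_kermxP yS0 y_neq0] := K_neq0.
pose x := y *m S.
have x0 i : 0 < a 0 i -> x 0 i = 0.
  move=> ai; have iP : i \in P by rewrite inE.
  have := congr1 (fun M : 'rV_ _ => M 0 (enum_rank_in iP i)) yS0.
  rewrite /x !mxE => yS0i; rewrite -[RHS]yS0i.
  by apply: eq_bigr => k _; rewrite mxE enum_rankK_in.
have /(congr1 (fun M : 'M_1 => M 0 0)) :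
    y *m diag_mx b *m y ^t* = x *m diag_mx a *m x ^t*.
  by rewrite -defb /x trmx_mul map_mxM !mulmxA.
rewrite !mulmx_diag_trmxC; apply/eqP; rewrite gt_eqF //.
apply: (@le_lt_trans _ _ 0).
  apply: sumr_le0 => i _; have [/x0 ->|] := boolP (0 < a 0 i).
    by rewrite normr0 expr0n mulr0.
  rewrite -real_leNgt ?real0 ?a_real // => ai.
  by rewrite mulr_le0_ge0 ?exprn_ge0.
have /rV0Pn[j yj] := y_neq0.
rewrite (bigD1 j) //= ltr_wpDr //.
  by apply: sumr_ge0 => k _; rewrite mulr_ge0 ?exprn_ge0 // ltW.
by rewrite mulr_gt0 ?exprn_gt0 ?normr_gt0.
Qed.

Lemma diag_pos_le (C : numClosedFieldType) n m (a : 'rV[C]_n)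
    (b : 'rV[C]_m) (S : 'M[C]_(m, n)) :
    (forall i, a 0 i \is Num.real) ->
    S *m diag_mx a *m S ^t* = diag_mx b ->
  (#|[set j | (0 < b 0 j)%R]| <= #|[set i | (0 < a 0 i)%R]|)%N.
Proof.
move=> a_real defb; set P := [set j | _].
apply: (@posdef_diag_le _ _ _ _ (\row_j b 0 (enum_val j))
  (rowsub (enum_val : 'I_#|P| -> _) S)) => // [j|].
  by rewrite mxE; have := enum_valP j; rewrite inE.
rewrite !mul_rowsub_mx; apply/matrixP=> i j.
have := congr1 (fun M : 'M_m => M (enum_val i) (enum_val j)) defb.
rewrite !mxE (inj_eq enum_val_inj) => <-.
by apply: eq_bigr => k _; rewrite !mxE.
Qed.

Lemma diag_neg_le (C : numClosedFieldType) n m (a : 'rV[C]_n)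
    (b : 'rV[C]_m) (S : 'M[C]_(m, n)) :
    (forall i, a 0 i \is Num.real) ->
    S *m diag_mx a *m S ^t* = diag_mx b ->
  (#|[set j | (b 0 j < 0)%R]| <= #|[set i | (a 0 i < 0)%R]|)%N.
Proof.
move=> a_real defb.
have := @diag_pos_le _ _ _ (- a) (- b) S; rewrite !raddfN /= mulNmx defb.
have E k (c : 'rV[C]_k) : [set j | 0 < (- c) 0 j] = [set j | c 0 j < 0].
  by apply/setP => j; rewrite !inE mxE oppr_gt0.
by rewrite !E; apply=> // i; rewrite mxE rpredN.
Qed.

Lemma char_poly_similar (R : comUnitRingType) n (P A : 'M[R]_n) :
  P \in unitmx -> char_poly (invmx P *m A *m P) = char_poly A.
Proof.
move=> P_unit; pose f := map_mx (@polyC R) : 'M_n -> 'M_n.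
have fM X Y : f (X *m Y) = f X *m f Y by exact: map_mxM.
have fVP : f (invmx P) *m f P = 1%:M by rewrite -fM mulVmx // /f map_mx1.
rewrite /char_poly.
have -> : char_poly_mx (invmx P *m A *m P) =
    f (invmx P) *m char_poly_mx A *m f P.
  rewrite /char_poly_mx -!/(f _) !fM mulmxBr mulmxBl; congr (_ - _).
  by rewrite scalar_mxC -mulmxA fVP mulmx1.
by rewrite !det_mulmx mulrAC -det_mulmx fVP det1 mul1r.
Qed.

(** Over [R[i]] the matrix is hermitian, hence unitarily diagonalizable with real eigenvalues, which
    descend to [R]. *)
Lemma real_symmetric_spectral (R : rcfType) n (A : 'M[R]_n) : A^T = A ->
  exists (a : 'rV[R]_n) (P : 'M[R[i]]_n),
    char_poly A = \prod_i ('X - (a 0 i)%:P) /\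
    map_mx (real_complex R) A =
      P *m diag_mx (map_mx (real_complex R) a) *m P ^t*.
Proof.
move=> A_sym; pose B := map_mx (real_complex R) A.
have B_herm : B \is hermsymmx.
  apply/is_hermitianmxP; rewrite scale1r; apply/matrixP=> i j.
  rewrite !mxE -[in LHS]A_sym mxE; apply/esym/CrealP.
  by apply/complex_realP; exists (A j i).
have a_real := hermitian_spectral_diag_real B_herm.
have /orthomx_spectralP B_eq := hermitian_normalmx B_herm.
pose Q := spectralmx B.
have Q_unit : Q \is unitarymx := spectral_unitarymx B.
pose a := map_mx (@complex.Re R) (spectral_diag B).
have aE : spectral_diag B = map_mx (real_complex R) a.
  apply/rowP=> i; rewrite !mxE RRe_real //.
  exact: (mxOverP a_real).
exists a, (Q ^t*); split; last first.
  by rewrite trmxCK -(invmx_unitary Q_unit) -aE.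
apply: (map_inj_poly (@complexI R) (rmorph0 _)).
rewrite map_char_poly rmorph_prod /= -/B B_eq aE.
rewrite char_poly_similar ?unitarymx_unit // char_poly_trig ?diag_mx_is_trig //.
by apply: eq_bigr => i _; rewrite map_polyXsubC !mxE eqxx mulr1n.
Qed.

Lemma inertia_count (R : rcfType) n (A : 'M[R]_n) (a : 'rV[R]_n) :
    char_poly A = \prod_i ('X - (a 0 i)%:P) ->
  inertia A = (#|[set i | (0 < a 0 i)%R]|, #|[set i | (a 0 i < 0)%R]|,
               #|[set i | (a 0 i == 0)%R]|)%N.
Proof.
move=> pA.
have cnt (P : pred R) :
    (\sum_(x <- spectrum A | P x) eigen_mult A x)%N = #|[set i | P (a 0 i)]|.
  (* The multiplicity of [x] is the number of [i] with [a 0 i = x]; count the pairs in two ways. *)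
  transitivity (\sum_i \sum_(x <- spectrum A | P x) ((a 0 i == x)%R))%N.
    rewrite exchange_big /=; apply: eq_bigr => x _.
    rewrite /eigen_mult pA -(big_map (a 0) xpredT (fun z => 'X - z%:P)) /=.
    by rewrite mu_prod_XsubC count_map -sum1_count big_mkcond.
  rewrite -sum1_card [RHS]big_mkcond /=; apply: eq_bigr => i _.
  rewrite inE; have ai : a 0 i \in spectrum A.
    rewrite mem_spectrum eigenvalue_root_char pA.
    rewrite /root horner_prod (bigD1 i) //= hornerXsubC subrr mul0r.
    exact: eqxx.
  rewrite big_mkcond (bigD1_seq (a 0 i)) ?spectrum_uniq //= eqxx.
  rewrite big1 ?addn0 //; last by move=> x /negPf xi; rewrite eq_sym xi if_same.
by rewrite /inertia !cnt.
Qed.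

(** Lower bounds suffice: since [p + q + z = n], they become equalities once they add up to [n]. *)
Lemma inertia_diag (R : rcfType) n m (A : 'M[R]_n) (b : 'rV[R]_m)
    (S : 'M[R]_(m, n)) : A^T = A -> S *m A *m S^T = diag_mx b ->
  exists p q z : nat,
    [/\ inertia A = (p, q, z), (p + q + z = n)%N,
        (#|[set j | (0 < b 0 j)%R]| <= p)%N,
        (#|[set j | (b 0 j < 0)%R]| <= q)%N &
        \det A = 0 -> (0 < z)%N].
Proof.
move=> A_sym defb; have [a [P [pA AE]]] := real_symmetric_spectral A_sym.
pose c k (x : 'rV[R]_k) : 'rV[R[i]]_k := map_mx (real_complex R) x.
have S_diag : (map_mx (real_complex R) S *m P) *m diag_mx (c _ a) *m
    (map_mx (real_complex R) S *m P) ^t* = diag_mx (c _ b).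
  rewrite trmx_mul map_mxM.
  have -> : (map_mx (real_complex R) S) ^t* = map_mx (real_complex R) S^T.
    apply/matrixP=> i j; rewrite !mxE; apply/CrealP.
    by apply/complex_realP; exists (S j i).
  rewrite !mulmxA -(mulmxA _ P) -(mulmxA _ (P *m _)) -AE.
  by rewrite -!map_mxM defb map_diag_mx.
have c_real i : c _ a 0 i \is Num.real.
  by apply/complex_realP; exists (a 0 i); rewrite mxE.
have Epos k (x : 'rV[R]_k) :
    [set j | 0 < c _ x 0 j] = [set j | 0 < x 0 j].
  by apply/setP=> j; rewrite !inE mxE ltcR.
have Eneg k (x : 'rV[R]_k) :
    [set j | c _ x 0 j < 0] = [set j | x 0 j < 0].
  by apply/setP=> j; rewrite !inE mxE ltcR.
have := diag_pos_le c_real S_diag; have := diag_neg_le c_real S_diag.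
rewrite !Epos !Eneg => le_neg le_pos.
do 3!eexists; split; first exact: inertia_count pA.
- have cardE (Q : pred R) : #|[set i | Q (a 0 i)]| = (\sum_i Q (a 0%R i))%N.
    by rewrite -sum1_card big_mkcond; apply: eq_bigr => i _; rewrite inE.
  rewrite (cardE (fun x => 0 < x)) (cardE (fun x => x < 0)) (cardE (pred1 0)).
  rewrite -!big_split /= -[RHS]card_ord -sum1_card.
  by apply: eq_bigr => i _; case: ltgtP.
- exact: le_pos.
- exact: le_neg.
(* At 0 the characteristic polynomial is the determinant up to sign, so [\det A = 0] forces some
   [a 0 i] to vanish. *)
have /(congr1 (fun p : {poly R} => p.[0])) := pA.
rewrite horner_coef0 char_poly_det => + A0.
rewrite A0 mulr0 => /esym/eqP; rewrite horner_prod prodf_seq_eq0.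
case/hasP=> i _ /=; rewrite hornerXsubC sub0r oppr_eq0 => ai.
by apply/card_gt0P; exists i; rewrite inE.
Qed.

(** * An orthogonal family for the eccentricity form of a fan *)

Definition delta (p q : nat) : int := if q == p then 1 else 0.

(** The solution 1, -1, 0, 1, -1, 0, ... of [f (q - 1) + f q + f (q + 1) = 0] that vanishes just
    before the start of the path. *)
Definition chi (q : nat) : int :=
  if (q %% 3 == 0)%N then 1 else if (q %% 3 == 1)%N then -1 else 0.

(* The [T]-orthogonal family: with [a_j, b_j, c_j] the vertices [3j, 3j+1, 3j+2],
   it consists of [alpha_j = chi] cut off after [a_j], [b_j - c_j - alpha_j] and
   [c_j]. *)
Definition path_vec (p q : nat) : int :=
  if (p %% 3 == 2)%N then delta p q
  else if (p %% 3 == 1)%N then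
    delta p q - delta p.+1 q - (if (q < p)%N then chi q else 0)
  else if (q <= p)%N then chi q else 0.

Definition path_sgn (p : nat) : int := if (p %% 3 == 1)%N then -1 else 1.

(* [T f] on the path [0, ..., m - 1]. *)
Definition tri m (f : nat -> int) (q : nat) : int :=
  (if q is q0.+1 then f q0 else 0) + f q + (if (q.+1 < m)%N then f q.+1 else 0).

(** The image of [path_vec p] under [T]: [T] kills [chi] away from the cut, so only a few deltas
    remain, one of them possibly beyond the path. *)
Definition path_dual (p q : nat) : int :=
  if (p %% 3 == 2)%N then delta p.-1 q + delta p q + delta p.+1 q
  else if (p %% 3 == 1)%N then - delta p q - delta p.+2 q
  else delta p q + delta p.+1 q.

(* The vector [path_vec p] is supported in the path [0, ..., m - 1]. *)
Definition path_index m p := (p < m)%N && ((p %% 3 == 1)%N ==> (p.+1 < m)%N).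

Ltac split_ifs_lia := rewrite /delta /chi; repeat match goal with
  |- context [if ?b then _ else _] =>
    let H := fresh in destruct b eqn:H; try (exfalso; lia) end; try lia.

Lemma path_vec_out m p q : path_index m p -> (m <= q)%N -> path_vec p q = 0.
Proof. rewrite /path_index /path_vec => ? ?; split_ifs_lia. Qed.

Lemma tri_path_vec m p q : path_index m p -> (q < m)%N ->
  tri m (path_vec p) q = path_dual p q.
Proof.
rewrite /path_index /path_vec /path_dual /tri => hp hq.
by case: q hq => [|q] hq; split_ifs_lia.
Qed.

(* The left-hand side is the pairing of [path_vec p'] with [path_dual p]. *)
Lemma path_vec_dual p p' :
  (if (p %% 3 == 2)%N then path_vec p' p.-1 + path_vec p' p + path_vec p' p.+1
   else if (p %% 3 == 1)%N then - path_vec p' p - path_vec p' p.+2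
   else path_vec p' p + path_vec p' p.+1) = if p' == p then path_sgn p else 0.
Proof.
by rewrite /path_sgn /path_vec; split_ifs_lia.
Qed.

(** The indicator of a perfect code of the path: the residue class mod 3 is chosen so that every
    closed neighbourhood meets it exactly once, at both ends too. *)
Definition path_sol m (q : nat) : int :=
  if (q %% 3 == (m %% 3 != 1))%N then 1 else 0.

Lemma tri_path_sol m q : (q < m)%N -> tri m (path_sol m) q = 1.
Proof. by rewrite /tri /path_sol; case: q => [|q] hq; split_ifs_lia. Qed.

Lemma path_sol_sum_gt0 m : (1 < m)%N -> 0 < \sum_(q < m) path_sol m q.
Proof.
move=> m_gt1; have lt_m : ((m %% 3 != 1) < m)%N by lia.
rewrite (bigD1 (Ordinal lt_m)) //= ltr_wpDr //.
  by apply: sumr_ge0 => q _; rewrite /path_sol; case: ifP.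
by rewrite /path_sol; split_ifs_lia.
Qed.

Lemma chi_sum m : (m %% 3 = 2)%N -> \sum_(q < m) chi q = 0.
Proof.
(* The induction needs the partial sums for all residues of [m]. *)
suff -> : \sum_(q < m) chi q = (if (m %% 3 == 1)%N then 1 else 0) by move=> ->.
by elim: m => [|m IHm]; rewrite ?big_ord0 // big_ord_recr /= IHm; split_ifs_lia.
Qed.

(** The recurrence for [chi] survives the truncation at the right end because [chi m = 0]. *)
Lemma tri_chi m q : (m %% 3 = 2)%N -> (q < m)%N -> tri m chi q = 0.
Proof. by rewrite /tri /chi => hm; case: q => [|q] hq; split_ifs_lia. Qed.

(** The index [k] may lie beyond the range, as happens for the outermost delta in [path_dual]. *)
Lemma sum_delta m (f : nat -> int) k :
  ((m <= k)%N -> f k = 0) -> \sum_(q < m) f q * delta k q = f k.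
Proof.
move=> f_out; case: (ltnP k m) => [lt_km|/f_out fk].
  rewrite (bigD1 (Ordinal lt_km)) //= /delta eqxx mulr1 big1 ?addr0 // => q.
  by rewrite -val_eqE /= => /negPf ->; rewrite mulr0.
rewrite fk big1 // => q _; rewrite /delta.
by case: eqP => [->|_]; rewrite ?fk ?mul0r ?mulr0.
Qed.

Lemma sum_path_vec_dual m p p' : path_index m p -> path_index m p' ->
  \sum_(q < m) path_vec p' q * path_dual p q =
  if p' == p then path_sgn p else 0.
Proof.
move=> hp hp'; rewrite -path_vec_dual.
have D k : \sum_(q < m) path_vec p' q * delta k q = path_vec p' k.
  by apply: sum_delta => /path_vec_out ->.
rewrite /path_dual; case: ifP => _; [|case: ifP => _].
- by rewrite -!D -!big_split; apply: eq_bigr => q _ /=; ring.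
- by rewrite -!D -!sumrN -!big_split; apply: eq_bigr => q _ /=; ring.
- by rewrite -!D -!big_split; apply: eq_bigr => q _ /=; ring.
Qed.

(** * The eccentricity form of the fan in corrected coordinates *)

Definition fan_ecc (i j : nat) : int :=
  if i == j then 0 else if (i == 0)%N || (j == 0)%N then 1
  else if (i == j.+1) || (j == i.+1) then 0 else 2.

Lemma fan_ecc_sym i j : fan_ecc i j = fan_ecc j i.
Proof. by rewrite /fan_ecc eq_sym orbC [X in if X then 0 else 2]orbC. Qed.

(* The vector with path coordinates [f] whose corrected hub coordinate is [X];
   the path vertex [q] has index [q.+1]. *)
Definition fan_vec m (X : int) (f : nat -> int) (i : nat) : int :=
  if i is q.+1 then f q else X - \sum_(q < m) f q.

Lemma fan_ecc_mul0 m X f :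
  \sum_(j < m.+1) fan_ecc 0 j * fan_vec m X f j = \sum_(q < m) f q.
Proof.
rewrite big_ord_recl mul0r add0r.
by apply: eq_bigr => q _; rewrite mul1r.
Qed.

(** Between path vertices the matrix is [2 J - 2 T], with [J] the all-ones matrix; [g] below is row
    [q] of [T]. *)
Lemma fan_ecc_mulS m X f q : (q < m)%N ->
  \sum_(j < m.+1) fan_ecc q.+1 j * fan_vec m X f j =
  X + \sum_(q < m) f q - 2 * tri m f q.
Proof.
move=> lt_qm; rewrite big_ord_recl /= [fan_ecc _ _]/= mul1r.
have D k : (k < m)%N -> \sum_(i < m) f i * delta k i = f k.
  by move=> lt_km; apply: sum_delta; rewrite leqNgt lt_km.
pose g i := (if q is q0.+1 then delta q0 i else 0) + delta q i + delta q.+1 i.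
have -> : tri m f q = \sum_(i < m) f i * g i.
  rewrite /tri /g; under eq_bigr => i _ do rewrite !mulrDr.
  rewrite !big_split /= D //; congr (_ + _ + _).
    case: q lt_qm {g} => [|q] lt_qm.
      by rewrite big1 // => i _; rewrite mulr0.
    by rewrite D // ltnW.
  case: ltnP => [/D //|le_mq]; rewrite big1 // => i _.
  have := ltn_ord i; rewrite /delta; case: eqP => [->|_ _]; last by rewrite mulr0.
  by rewrite ltnNge le_mq.
rewrite (_ : \sum_(i < m) fan_ecc _ _ * _ =
    2 * \sum_(i < m) f i - 2 * \sum_(i < m) f i * g i); first by ring.
rewrite !mulr_sumr -sumrB; apply: eq_bigr => i _.
rewrite /bump /= add1n (_ : fan_ecc q.+1 i.+1 = 2 - 2 * g i); first by ring.
by rewrite /fan_ecc /g; case: q lt_qm {g} => [|q] lt_qm; split_ifs_lia.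
Qed.

Definition fan_form m (x y : nat -> int) : int :=
  \sum_(i < m.+1) x i * \sum_(j < m.+1) fan_ecc i j * y j.

Lemma fan_form_sym m x y : fan_form m x y = fan_form m y x.
Proof.
rewrite /fan_form; under eq_bigr do rewrite mulr_sumr.
rewrite exchange_big; apply: eq_bigr => i _; rewrite mulr_sumr.
by apply: eq_bigr => j _; rewrite fan_ecc_sym mulrCA mulrA mulrC mulrA.
Qed.

(** The correction of the hub coordinate makes the products of the sums of [f] and [g] cancel. *)
Lemma fan_form_vec m X Y f g :
  fan_form m (fan_vec m X f) (fan_vec m Y g) =
  X * (\sum_(q < m) g q) + Y * (\sum_(q < m) f q)
  - 2 * \sum_(q < m) f q * tri m g q.
Proof.
rewrite /fan_form big_ord_recl fan_ecc_mul0.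
have -> : \sum_(i < m) fan_vec m X f (lift ord0 i) *
      (\sum_(j < m.+1) fan_ecc (lift ord0 i) j * fan_vec m Y g j) =
    (\sum_(q < m) f q) * (Y + \sum_(q < m) g q) -
    2 * \sum_(q < m) f q * tri m g q.
  rewrite mulr_suml mulr_sumr -sumrB; apply: eq_bigr => q _.
  rewrite [fan_vec m X f _]/=.
  by rewrite (_ : lift ord0 q = q.+1 :> nat) // fan_ecc_mulS //; ring.
by rewrite /=; ring.
Qed.

(** The hub coordinate 2 makes [2 * \sum f] cancel [- 2 f^T T x] for [T x = 1], so that the first
    vector is orthogonal to every vector with [X = 0]. *)
Definition fan_basis m (k : nat) : nat -> int :=
  if k is p.+1 then fan_vec m 0 (path_vec p) else fan_vec m 2 (path_sol m).

Definition fan_diag m (k : nat) : int :=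
  if k is p.+1 then -2 * path_sgn p else 2 * \sum_(q < m) path_sol m q.

(** When [m] is 2 mod 3, [path_vec m.-1] would stick out of the path and is dropped. *)
Definition fan_rank m : nat := (m.+1 - (m %% 3 == 2))%N.

Lemma fan_basis_orthogonal m k l : (k < fan_rank m)%N -> (l < fan_rank m)%N ->
  fan_form m (fan_basis m k) (fan_basis m l) =
  if k == l then fan_diag m k else 0.
Proof.
have idx p : (p.+1 < fan_rank m)%N -> path_index m p.
  by rewrite /fan_rank /path_index; lia.
have sol0 X f : fan_form m (fan_vec m X f) (fan_basis m 0) =
    X * \sum_(q < m) path_sol m q.
  rewrite fan_form_vec (_ : \sum_(q < m) f q * _ = \sum_(q < m) f q).
    by ring.
  by apply: eq_bigr => q _; rewrite tri_path_sol ?mulr1.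
case: l => [|l]; first by case: k => [|k] _ _; rewrite sol0 ?mul0r.
case: k => [_ _|k /idx hk /idx hl].
  by rewrite fan_form_sym sol0 mul0r.
rewrite fan_form_vec !mul0r addr0 sub0r.
rewrite (_ : \sum_(q < m) _ = \sum_(q < m) path_vec k q * path_dual l q).
  rewrite sum_path_vec_dual // eqSS /=; case: eqP => [->|_]; ring.
by apply: eq_bigr => q _; rewrite tri_path_vec.
Qed.

Lemma fan_kernel m i : (m %% 3 = 2)%N -> (i <= m)%N ->
  \sum_(j < m.+1) fan_ecc i j * fan_vec m 0 chi j = 0.
Proof.
move=> m2; case: i => [_|q lt_qm]; first by rewrite fan_ecc_mul0 chi_sum.
by rewrite fan_ecc_mulS // chi_sum // tri_chi.
Qed.

Lemma sum_mod3_eq1 m : (\sum_(p < m) (p %% 3 == 1) = m.+1 %/ 3)%N.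
Proof.
elim: m => [|m IHm]; first by rewrite big_ord0.
by rewrite big_ord_recr /= IHm; lia.
Qed.

Lemma sum_mod3_neq1 m : (\sum_(p < m) (p %% 3 != 1) = m - m.+1 %/ 3)%N.
Proof.
elim: m => [|m IHm]; first by rewrite big_ord0.
by rewrite big_ord_recr /= IHm; lia.
Qed.

(** * The eccentricity matrix of a wheel minus a cycle edge *)

Lemma has_path_of_length0 (T : finType) (e : rel T) x y :
  has_path_of_length e x y 0 = (x == y).
Proof.
apply/existsP/idP => [[p]|xy]; first by rewrite tuple0 /= => /andP[].
by exists [tuple]; rewrite /= xy.
Qed.

Lemma has_path_of_length1 (T : finType) (e : rel T) x y :
  has_path_of_length e x y 1 = e x y && (x != y).
Proof.
apply/existsP/andP => [[p]|[exy xy]].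
  case/tupleP: p => z p; rewrite tuple0 /= andbT inE andbT.
  by case/and3P=> exz /eqP <- ->.
by exists [tuple y]; rewrite /= exy eqxx inE xy.
Qed.

(** Distinct nonadjacent vertices both differ from [h] and are joined through it. *)
Lemma dist_hub (T : finType) (e : rel T) (h : T) :
    symmetric e -> irreflexive e -> (forall x, x != h -> e x h) ->
  forall x y, dist e x y = if x == y then 0%N else if e x y then 1%N else 2%N.
Proof.
move=> e_sym e_irr e_hub x y.
have [->|xy] := eqVneq x y.
  by apply/eqP; rewrite -leqn0 dist_min // has_path_of_length0.
have conn_h z : connect e z h.
  have [->|/e_hub/connect1 //] := eqVneq z h; exact: connect0.
have conn : connect e x y.
  by apply: connect_trans (conn_h x) _; rewrite sym_connect_sym.
have := dist_path conn.
have [exy|nexy] := boolP (e x y).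
  have : (dist e x y <= 1)%N by rewrite dist_min // has_path_of_length1 exy.
  by case: (dist e x y) => [|[|]] //; rewrite has_path_of_length0 (negPf xy).
have yh : y != h by apply: contraNneq nexy => yh; rewrite yh e_hub // -yh.
have xh : x != h.
  by apply: contraNneq nexy => xh; rewrite xh e_sym e_hub // -xh eq_sym.
have : (dist e x y <= 2)%N.
  rewrite dist_min //; apply/existsP; exists [tuple h; y] => /=.
  by rewrite e_hub // e_sym e_hub // eqxx !inE negb_or xh xy eq_sym yh.
case: (dist e x y) => [|[|[|]]] //.
  by rewrite has_path_of_length0 (negPf xy).
by rewrite has_path_of_length1 (negPf nexy).
Qed.

Lemma ecc_hub (T : finType) (e : rel T) (h y : T) :
    symmetric e -> irreflexive e -> (forall x, x != h -> e x h) -> y != h ->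
  ecc e h = 1%N.
Proof.
move=> e_sym e_irr e_hub yh; have D := dist_hub e_sym e_irr e_hub.
apply/eqP; rewrite eqn_leq; apply/andP; split.
  apply/bigmax_leqP => z _; rewrite D; case: eqVneq => // hz.
  by rewrite e_sym e_hub // eq_sym.
by have := leq_bigmax (F := dist e h) y; rewrite D eq_sym (negPf yh) e_sym e_hub.
Qed.

Lemma ecc_nonadjacent (T : finType) (e : rel T) (h x y : T) :
    symmetric e -> irreflexive e -> (forall x, x != h -> e x h) ->
    x != y -> ~~ e x y ->
  ecc e x = 2%N.
Proof.
move=> e_sym e_irr e_hub xy nexy; have D := dist_hub e_sym e_irr e_hub.
apply/eqP; rewrite eqn_leq; apply/andP; split.
  by apply/bigmax_leqP => z _; rewrite D; case: ifP => // _; case: ifP.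
by have := leq_bigmax (F := dist e x) y; rewrite D (negPf xy) (negPf nexy).
Qed.

(* Position of the wheel vertex [i] in the fan obtained by deleting the edge from
   the predecessor of [v] to [v]: the path starts at [v]. *)
Definition fan_pos n (v i : nat) : nat :=
  if i == 0%N then 0%N else if (v <= i)%N then (i - v).+1 else (i + n - v)%N.

Definition fan_adj (a b : nat) : bool :=
  (a != b) && [|| a == 0%N, b == 0%N, a == b.+1 | b == a.+1].

Lemma del_edgeC (T : finType) (e : rel T) u v : del_edge e u v =2 del_edge e v u.
Proof. by move=> x y; rewrite /del_edge /= (setUC [set u]). Qed.

Lemma eq_set2 (T : finType) (x y u v : T) :
  ([set x; y] == [set u; v]) =
  ((x == u) && (y == v)) || ((x == v) && (y == u)).
Proof.
apply/eqP/idP => [E|/orP[]/andP[/eqP-> /eqP->] //]; last by rewrite setUC.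
have := set21 u v; have := set22 u v; rewrite -E !inE !(eq_sym _ x) !(eq_sym _ y).
have := set21 x y; have := set22 x y; rewrite E !inE.
by case: (x == u); case: (x == v); case: (y == u); case: (y == v).
Qed.

Lemma wheelE n (x y : 'I_n) : wheel x y = ((x : nat) != y) &&
  [|| x == 0%N :> nat, y == 0%N :> nat, y == x.+1 :> nat, x == y.+1 :> nat,
      (x == n.-1 :> nat) && (y == 1%N :> nat)
    | (y == n.-1 :> nat) && (x == 1%N :> nat)].
Proof.
rewrite /wheel /cycle_edge /cycle_succ /= -val_eqE /= !lt0n.
by case: (x == 0%N :> nat); case: (y == 0%N :> nat);
  case: (x == y :> nat); rewrite //= ?orbT // orbACA -!orbA.
Qed.

(** Counting positions from [v], each step along the cycle adds 1, except the deleted one, from [u]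
    at position [n - 1] to [v] at position 1. *)
Lemma del_cycle_succE n (u v : 'I_n) : (5 <= n)%N -> cycle_succ u v ->
  forall x y,
    del_edge (@wheel n) u v x y = fan_adj (fan_pos n v x) (fan_pos n v y).
Proof.
move=> n5 uv x y; rewrite /del_edge [LHS]/= wheelE eq_set2 -!val_eqE /=.
rewrite /cycle_succ in uv.
rewrite /fan_adj /fan_pos.
case: u v x y uv => [u ltu] [v ltv] [x ltx] [y lty] /= /and3P[u0 v0 uv].
have [x0|x0] := posnP x; have [y0|y0] := posnP y; subst => /=.
all: case/orP: uv => [/eqP|/andP[/eqP E /eqP]] E'; subst => /=.
all: try (case: (leqP _ x) => ?); try (case: (leqP _ y) => ?).
all: lia.
Qed.

Lemma fan_pos_perm n (v : 'I_n) : (0 < v)%N ->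
  {s : 'S_n | forall i, s i = fan_pos n v i :> nat}.
Proof.
move=> v0.
have ltn_pos i : (i < n)%N -> (fan_pos n v i < n)%N.
  by have := ltn_ord v; rewrite /fan_pos; do !case: ifP => ?; lia.
have f_inj : injective (fun i : 'I_n => Ordinal (ltn_pos i (ltn_ord i))).
  move=> i j /(congr1 val) /= E; apply: val_inj => /=; move: E.
  have := ltn_ord v; have := ltn_ord i; have := ltn_ord j; rewrite /fan_pos.
  by do !case: ifP => ?; lia.
by exists (perm f_inj) => i; rewrite permE.
Qed.

Lemma ecc_mx_fan (R : rcfType) n (e : rel 'I_n) (s : 'S_n) : (5 <= n)%N ->
    (forall x y, e x y = fan_adj (s x) (s y)) ->
  ecc_mx R e = \matrix_(i, j) (fan_ecc (s i) (s j))%:~R.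
Proof.
case: n e s => // n e s n5 eE.
pose h := (s^-1)%g ord0.
have s0 x : (s x == 0%N :> nat) = (x == h).
  by rewrite -(inj_eq (@perm_inj _ s)) permKV.
have e_sym : symmetric e.
  by move=> x y; rewrite !eE /fan_adj; apply/idP/idP; lia.
have e_irr : irreflexive e by move=> x; rewrite eE /fan_adj eqxx.
have e_hub x : x != h -> e x h.
  by rewrite eE /fan_adj permKV orbT andbT s0.
have ecch : ecc e h = 1%N.
  apply: (ecc_hub (y := (s^-1)%g ord_max) e_sym e_irr e_hub).
  by rewrite (inj_eq perm_inj) -val_eqE /=; lia.
have eccN0 x : x != h -> ecc e x = 2%N.
  (* A nonneighbour of [x]: position 4 is not adjacent to 1 and 2, position 1 not to 3 and beyond.
     Position 4 exists because there are at least 5 vertices. *)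
  move=> x0; have lt_b : ((if (s x <= 2)%N then 4 else 1) < n.+1)%N.
    by case: ifP; lia.
  pose y := (s^-1)%g (Ordinal lt_b).
  have sy : s y = (if (s x <= 2)%N then 4 else 1)%N :> nat.
    by rewrite /y permKV.
  have sx0 : s x != 0%N :> nat by rewrite s0.
  apply: (ecc_nonadjacent (y := y) e_sym e_irr e_hub).
    by apply: contra_eqN sy => /eqP <-; case: ifP; lia.
  by rewrite eE /fan_adj sy; case: ifP; lia.
apply/matrixP => x y; rewrite !mxE (dist_hub e_sym e_irr e_hub) eE.
rewrite /fan_adj /fan_ecc !s0 (inj_eq val_inj) (inj_eq perm_inj).
have [->|xy] := eqVneq x y; first by rewrite if_same.
have [->|x0] := eqVneq x h.
  by rewrite ecch /=; have [->|/eccN0 ->] := eqVneq y h; rewrite ?ecch.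
have [->|y0] := eqVneq y h; first by rewrite ecch eccN0.
by rewrite !eccN0 //=; case: (_ || _).
Qed.

(** * The inertia of the fan and the conclusion for the wheel *)

Lemma inertia_fan (R : rcfType) m (s : 'S_m.+1) : (1 < m)%N ->
  inertia (\matrix_(i, j) (fan_ecc (s i) (s j))%:~R : 'M[R]_m.+1) =
  ((fan_rank m %/ 3).+1, (fan_rank m).-1 - fan_rank m %/ 3,
   ((m %% 3 == 2) : nat))%N.
Proof.
move=> m_gt1; set A := \matrix_(i, j) _.
pose S : 'M[R]_(fan_rank m, m.+1) := \matrix_(k, i) (fan_basis m k (s i))%:~R.
pose b : 'rV[R]_(fan_rank m) := \row_k (fan_diag m k)%:~R.
have A_sym : A^T = A by apply/matrixP => i j; rewrite !mxE fan_ecc_sym.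
have defb : S *m A *m S^T = diag_mx b.
  apply/matrixP => k l; rewrite -mulmxA !mxE.
  have := fan_basis_orthogonal (ltn_ord k) (ltn_ord l).
  move/(congr1 (fun x : int => x%:~R : R)); rewrite /fan_form.
  rewrite (reindex_inj (@perm_inj _ s)) /= rmorph_sum /= => E.
  rewrite (_ : _ *+ _ = (if k == l :> nat then fan_diag m k else 0)%:~R);
    last by rewrite val_eqE; case: eqP.
  rewrite -E; apply: eq_bigr => i _; rewrite rmorphM mxE; congr (_ * _).
  rewrite mxE [X in _ = _ X](reindex_inj (@perm_inj _ s)) /= rmorph_sum.
  by apply: eq_bigr => j _; rewrite rmorphM !mxE.
have [p [q [z [-> pqz le_p le_q z_gt0]]]] := inertia_diag A_sym defb.
have r_gt0 : (0 < fan_rank m)%N by rewrite /fan_rank; lia.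
have card_b (Q : pred R) (P : pred nat) :
    (forall k, Q (fan_diag m k)%:~R = P k) ->
    #|[set j | Q (b 0 j)]| = (P 0%N + \sum_(k < (fan_rank m).-1) P k.+1)%N.
  move=> QP; rewrite -sum1_card big_mkcond /=.
  transitivity (\sum_(j < fan_rank m) P j)%N.
    by apply: eq_bigr => j _; rewrite inE mxE QP; case: (P _).
  have recl r : (0 < r)%N -> (\sum_(j < r) P j = P 0 + \sum_(k < r.-1) P k.+1)%N.
    by case: r => // r _; rewrite big_ord_recl.
  exact: recl.
have sol_gt0 := path_sol_sum_gt0 m_gt1.
(* The factor -2 in [fan_diag] reverses signs: the positive entries are the hub vector and the [p]
   that are 1 mod 3. *)
rewrite (card_b (fun x => 0 < x)
  (fun k => if k is k'.+1 then k' %% 3 == 1 else true)%N) in le_p; last first.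
  case=> [|k] /=; rewrite ltr0z; first by rewrite pmulr_rgt0.
  by rewrite /path_sgn; case: ifP.
rewrite (card_b (fun x => x < 0)
  (fun k => if k is k'.+1 then k' %% 3 != 1 else false)%N) in le_q; last first.
  case=> [|k] /=; rewrite ltrz0; last by rewrite /path_sgn; case: ifP.
  by rewrite pmulr_rlt0 // ltNge ltW.
rewrite sum_mod3_eq1 prednK //= in le_p.
rewrite sum_mod3_neq1 prednK //= in le_q.
have le_z : ((m %% 3 == 2)%N <= z)%N.
  case: eqP => // m2; apply: z_gt0; apply/eqP/det0P.
  exists (\row_i (fan_vec m 0 chi (s i))%:~R).
    (* The first path vertex, of index 1, carries [chi 0 = 1]. *)
    apply/rV0Pn; exists ((s^-1)%g (Ordinal (leqW m_gt1))).
    by rewrite mxE permKV oner_eq0.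
  apply/rowP => i; rewrite !mxE.
  have := fan_kernel m2 (ltn_ord (s i) : (s i <= m)%N).
  move/(congr1 (fun x : int => x%:~R : R)).
  rewrite (reindex_inj (@perm_inj _ s)) /= rmorph_sum /= => E.
  rewrite -[RHS]E; apply: eq_bigr => j _.
  by rewrite rmorphM !mxE fan_ecc_sym mulrC.
(* The three lower bounds add up to [m.+1], so all are attained. *)
move: pqz le_p le_q le_z; rewrite /fan_rank => *.
by congr (_, _, _); lia.
Qed.

Theorem lemma4p4 (R : rcfType) (n : nat) (u v : 'I_n)
    (n_ge5 : (5 <= n)%N) (uv_edge : cycle_edge u v) :
  inertia (ecc_mx R (del_edge (@wheel n) u v)) =
    (if n %% 3 == 0 then (n %/ 3, (2 * n - 3) %/ 3, 1)
     else if n %% 3 == 1 then ((n + 2) %/ 3, (2 * n - 2) %/ 3, 0)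
     else ((n + 1) %/ 3, (2 * n - 1) %/ 3, 0))%N.
Proof.
have [s eE] : exists s : 'S_n, forall x y,
    del_edge (@wheel n) u v x y = fan_adj (s x) (s y).
  have pos_perm u' v' : cycle_succ u' v' -> exists s : 'S_n, forall x y,
      del_edge (@wheel n) u' v' x y = fan_adj (s x) (s y).
    move=> uv; have [|s sE] := @fan_pos_perm _ v'; first by case/and3P: uv.
    by exists s => x y; rewrite !sE (del_cycle_succE n_ge5 uv).
  (* Either orientation of the edge may be the successor step; the deletion is symmetric in its
     ends. *)
  case/andP: uv_edge => _ /orP[/pos_perm //|/pos_perm[s sE]].
  by exists s => x y; rewrite del_edgeC sE.
rewrite (ecc_mx_fan R n_ge5 eE).
case: n s n_ge5 {u v uv_edge eE} => // m s m_ge4.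
rewrite inertia_fan /fan_rank; last by lia.
by case: ifP => ?; [|case: ifP => ?]; congr (_, _, _); lia.
Qed.
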